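(* For every graph $H$ there is a constant $c_H>0$ such that for every integer $d\ge 3$, every $H$-free graph with minimum degree at least $d$ contains an induced bipartite subgraph of minimum degree at least $c_H\,\dfrac{\log d}{\log\log d}$.
   Context: All graphs are finite and simple, with non-empty vertex set. A graph is $H$-free if it contains no (not necessarily induced) subgraph isomorphic to $H$. An induced bipartite subgraph of $G$ is an induced subgraph $G[U]$, with $U\subseteq V(G)$ non-empty, that is bipartite. $\log$ is the natural logarithm. *)

(* Defs.v *)
From mathcomp Require Import all_boot.

Set Implicit Arguments.
Unset Strict Implicit.
Unset Printing Implicit Defensive.

Record sgraph := SGraph {
  vertex :> finType;
  adj : rel vertex;
  adj_sym : symmetric adj;
  adj_irr : irreflexive adj }.

Definition degree (G : sgraph) (x : G) : nat := #|[set y : G | adj x y]|.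

(* Degrees are less than #|G|, so on a non-empty graph the default value #|G|
   of the iterated minimum is never the result. *)
Definition min_degree (G : sgraph) : nat := \big[minn/#|G|]_(x : G) degree x.

Section Induced.
Variables (G : sgraph) (U : {set G}).

Definition induced_adj : rel {x : G | x \in U} :=
  [rel x y | adj (val x) (val y)].

Lemma induced_adj_sym : symmetric induced_adj.
Proof. by move=> x y; apply: adj_sym. Qed.

Lemma induced_adj_irr : irreflexive induced_adj.
Proof. by move=> x; apply: adj_irr. Qed.

Definition induced : sgraph := SGraph induced_adj_sym induced_adj_irr.

End Induced.

(* The vertices f x and the edges {f x, f y}, for {x, y} an edge of H, form the
   (not necessarily induced) subgraph of G isomorphic to H. *)
Definition contains_subgraph (H G : sgraph) : Prop :=
  exists2 f : H -> G, injective f & forall x y : H, adj x y -> adj (f x) (f y).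

Definition subgraph_free (H G : sgraph) : Prop := ~ contains_subgraph H G.

Definition bipartite (G : sgraph) : Prop :=
  exists A : {set G}, forall x y : G, adj x y -> (x \in A) != (y \in A).

(* Main.v *)
Require Import Defs.
From mathcomp Require Import all_boot all_order all_algebra.
From mathcomp Require Import zify ring lra.
From mathcomp Require Import reals exp.

(** It suffices to find two stable sets F and B with |B| < |F| such that every
    vertex of F has at least 4k neighbours in B: their union induces a bipartite
    graph of average degree above 2k, which contains one of minimum degree at
    least k ([bipartite_core_of_pair]).  The sets are found when k is a small
    multiple of log d / log log d.

    Suppose first that all neighbourhoods are sparse, namely e-degenerate for
    some e much smaller than d.  After passing to a subgraph, d is both a lower
    bound for the degrees and an upper bound for the degeneracy, so the edges
    can be oriented with out-degrees at most d.  Put t = 4k and let B be a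
    random set of density 1/(16td).  A vertex a has d neighbours, most of whose
    t-subsets are stable, and the expected number p(a) of suitable stable t-sets
    of neighbours inside B is at least t^(-O(t)).  This is large compared with
    1/d precisely because t = O(log d / log log d).  So a vertex seeing such a
    t-set can afford to be kept only with probability 1/(8d p(a)), which makes
    the candidates for F a set of density about 1/(8d).  This density is low
    enough that a candidate rarely has a candidate among its at most d
    out-neighbours b, as long as the events for a and for b are nearly
    independent; they are for all but few b, because the neighbourhood of a is
    sparse.  It is rare, too, that a vertex of the t-set has an out-neighbour in
    B.  After deletion F still has density at least 5/(64d), more than the
    density 1/(16td) of B ([exists_sample], [sparse_nbhds_stable_pair]).

    If some neighbourhood is not sparse, then it contains a subgraph of minimum
    degree e.  An H-free graph has no clique of size s = |H|, and a neighbourhood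
    has no clique of size s - 1, so one can induct on s
    ([clique_free_bipartite_core]).  Each step divides the minimum degree by
    t^(O(t)), so the argument succeeds when d is at least t^(O(st)), which
    allows k of order log d / log log d ([threshold_le]). *)

Set Implicit Arguments.
Unset Strict Implicit.
Unset Printing Implicit Defensive.

Import Order.TTheory GRing.Theory Num.Theory.

(** * Random subsets of a finite type *)

Section RandomSets.
Local Open Scope ring_scope.
Variables (R : realFieldType) (T : finType).
Implicit Types (w : T -> R) (X Y : {set T}).

(** The law of a random subset that contains each [x] independently with
    probability [w x]. *)
Definition bern w X : R := \prod_x (if x \in X then w x else 1 - w x).

Lemma bern_ge0 w X : (forall x, 0 <= w x <= 1) -> 0 <= bern w X.
Proof.
move=> w01; apply: prodr_ge0 => x _; have /andP[w0 w1] := w01 x.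
by case: ifP => // _; rewrite subr_ge0.
Qed.

(** Expanding the product over [x] of [w x + (0 or 1 - w x)] enumerates the
    sets containing [Y].  Events of this form are the only ones whose
    probability is ever computed. *)
Lemma bern_superset w Y :
  \sum_X bern w X * (Y \subset X)%:R = \prod_(x in Y) w x.
Proof.
transitivity (\prod_x (w x + (if x \in Y then 0 else 1 - w x))).
  rewrite bigA_distr; apply: eq_bigr => X _.
  case: (boolP (Y \subset X)) => [YX|/subsetPn[y yY yX]].
    rewrite mulr1; apply: eq_bigr => x _; case: ifP => // xX.
    by case: ifP => // xY; rewrite (subsetP YX) in xX.
  by rewrite mulr0 (bigD1 y) //= (negPf yX) yY mul0r.
rewrite [RHS]big_mkcond; apply: eq_bigr => x _.
by case: ifP => _; rewrite ?addr0 // addrC subrK.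
Qed.

(** Given that [X] lies in a random set of density [q], this sum is the expected
    number of subsets of [Y] lying in it as well.  It is at most the product of
    2 over [X] and of [1 + q] over the rest of [Y].  The bound is crude, but it
    is only applied to the few sets [Y] that meet [X]. *)
Lemma sum_pow_superset (q : R) (m : nat) (X Y : {set T}) :
  0 <= q -> (#|Y| <= m)%N -> m%:R * q <= 2^-1 ->
  \sum_(Z : {set T} | Z \subset Y) q ^+ #|Z :\: X| <= 2 ^+ #|X|.+1.
Proof.
move=> q0 Ym mq.
pose f x := if x \in X then 1 else q.
have f0 x : 0 <= f x by rewrite /f; case: ifP.
apply: (@le_trans _ _ (\prod_(x in Y) (1 + f x))).
  pose g x := if x \in Y then f x else 0.
  have -> : \prod_(x in Y) (1 + f x) = \prod_x (g x + 1).
    rewrite big_mkcond; apply: eq_bigr => x _.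
    by rewrite /g; case: ifP; rewrite ?add0r // addrC.
  rewrite bigA_distr big_mkcond /=; apply: ler_sum => Z _.
  case: ifP => ZY; last first.
    apply: prodr_ge0 => x _; case: ifP => // _.
    by rewrite /g; case: ifP.
  rewrite -prodr_const big_mkcond /=; apply: ler_prod => x _.
  rewrite in_setD; case: ifP => [/andP[xX xZ]|].
    by rewrite xZ /g (subsetP ZY) // /f (negPf xX) lexx andbT.
  case: (boolP (x \in Z)) => xZ; last by rewrite ler01 lexx.
  by rewrite andbT => /negbFE xX; rewrite /g (subsetP ZY) // /f xX ler01 lexx.
have H : \prod_(x in Y) (1 + f x) <= 2 ^+ #|X| * (1 + q) ^+ m.
  rewrite (bigID (mem X)) /=; apply: ler_pM.
  - by apply: prodr_ge0 => x _; rewrite addr_ge0.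
  - by apply: prodr_ge0 => x _; rewrite addr_ge0.
  - rewrite (eq_bigr (fun=> 2)); last first.
      by move=> x /andP[_ xX]; rewrite /f xX; ring.
    rewrite prodr_const ler_eXn2l ?ltr1n //.
    by apply: subset_leq_card; apply/subsetP => x /andP[].
  - rewrite (eq_bigr (fun=> 1 + q)); last first.
      by move=> x /andP[_ xX]; rewrite /f (negPf xX).
    rewrite prodr_const ler_weXn2l ?lerDl //; apply: leq_trans Ym.
    by apply: subset_leq_card; apply/subsetP => x /andP[].
apply: le_trans H _; rewrite exprSr ler_pM2l ?exprn_gt0 ?ltr0n //.
(* (1 + q)^m is at most 1 / (1 - q)^m, and (1 - q)^m >= 1 - m q >= 1/2 *)
have [->|m0] := posnP m; first by rewrite expr0 ler1n.
have q1 : q <= 2^-1.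
  apply: le_trans mq; rewrite ler_peMl // ler1n //.
have Bern k : (1 - q) ^+ k >= 1 - k%:R * q.
  elim: k => [|k IH]; first by rewrite mul0r subr0 expr0.
  have : (1 - q) ^+ k * (1 - q) >= (1 - k%:R * q) * (1 - q).
    by rewrite ler_wpM2r //; lra.
  have : 0 <= k%:R * q * q by rewrite !mulr_ge0.
  by rewrite exprSr -natr1; lra.
have h1 : (1 + q) ^+ m * (1 - q) ^+ m <= 1.
  rewrite -exprMn; apply: exprn_ile1; nra.
have h2 := Bern m.
have h3 : 0 <= (1 + q) ^+ m by rewrite exprn_ge0 // addr_ge0.
nra.
Qed.


Definition expect (I : finType) (p : I -> R) (f : I -> R) : R :=
  \sum_i p i * f i.

Lemma expectB (I : finType) (p f g : I -> R) :
  expect p (fun i => f i - g i) = expect p f - expect p g.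
Proof.
by rewrite /expect -sumrB; apply: eq_bigr => i _; rewrite mulrBr.
Qed.

Lemma expect_sum (I J : finType) (P : pred J) (p : I -> R) (f : J -> I -> R) :
  expect p (fun i => \sum_(j | P j) f j i) = \sum_(j | P j) expect p (f j).
Proof.
rewrite /expect exchange_big; apply: eq_bigr => i _ /=.
by rewrite mulr_sumr.
Qed.

Lemma expect_pos (I : finType) (p f : I -> R) :
  (forall i, 0 <= p i) -> 0 < expect p f -> exists i, 0 < f i.
Proof.
move=> p0 ef; apply/existsP; apply: contraTT ef => /existsPn H.
rewrite -leNgt; apply: sumr_le0 => i _.
by rewrite mulr_ge0_le0 // leNgt H.
Qed.

(** The law of a pair [(B, S)] of independent random sets, [B] of constant
    density [q]. *)
Definition bern2 (q : R) (rho : T -> R) (BS : {set T} * {set T}) : R :=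
  bern (fun=> q) BS.1 * bern rho BS.2.

Lemma expect_superset (q : R) rho X Y :
  expect (bern2 q rho) (fun BS => (X \subset BS.1)%:R * (Y \subset BS.2)%:R)
  = q ^+ #|X| * \prod_(y in Y) rho y.
Proof.
rewrite -prodr_const -!bern_superset big_distrlr /= pair_big /=.
by apply: eq_bigr => BS _; rewrite /bern2 mulrACA.
Qed.

End RandomSets.

(** * Sampling and deletion *)

Section Sampling.
Local Open Scope ring_scope.
Variables (R : realFieldType) (T : finType) (W : {set T}) (d t : nat).
Variables (rho : T -> R) (back : T -> {set T}) (fam : T -> {set {set T}}).
Variable (Z : T -> {set T} -> {set T}).

(* In the application [back a] is the set of out-neighbours of [a] in an
   orientation of the graph on [W] with out-degrees at most [d], [fam a] is a
   family of stable [t]-sets of neighbours of [a], and [Z a X] contains every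
   vertex whose presence in [B] would spoil [X] as a witness for [a]: an
   out-neighbour of [X], or another neighbour of [a] from which members of
   [fam a] are drawn. *)

Let q : R := (16 * t * d)%:R^-1.

Definition isolated (B : {set T}) a (X : {set T}) :=
  [&& X \in fam a, X \subset B & [disjoint Z a X & B]].

(** An active vertex is one that might be chosen.  Blocking [a] as soon as some
    out-neighbour is active, rather than chosen, keeps the blocking event a
    union of events [Y \subset B] and [b \in S]. *)
Definition active (B S : {set T}) a :=
  (a \in S) && [exists X in fam a, X \subset B].

Definition chosen (B S : {set T}) :=
  [set a in W | [&& a \in S, [exists X, isolated B a X] &
                    [forall b in back a, ~~ active B S b]]].

(* The inclusion-exclusion lower bound for [a] being chosen with witness [X]:
   the event that [X] is seen, minus one event for each possible spoiler and
   one for each possible active out-neighbour. *)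
Let gain (a : T) (X : {set T}) (BS : {set T} * {set T}) : R :=
  (X \subset BS.1)%:R * ([set a] \subset BS.2)%:R
  - \sum_(z in Z a X) (z |: X \subset BS.1)%:R * ([set a] \subset BS.2)%:R
  - \sum_(b in back a) \sum_(Y in fam b)
      (X :|: Y \subset BS.1)%:R * ([set a; b] \subset BS.2)%:R.

(* This makes two members of [fam a] that are both isolated in [B] coincide. *)
Hypothesis famZ :
  forall a X Y, a \in W -> X \in fam a -> Y \in fam a -> Y \subset X :|: Z a X.

(** At most one [X] is isolated, so the gains never count [a] twice: a summand is
    positive only if [X] is isolated and [a] is chosen. *)
Lemma sum_gain_le a BS : a \in W ->
  \sum_(X in fam a) gain a X BS <= (a \in chosen BS.1 BS.2)%:R.
Proof.
case: BS => B S aW /=.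
have gainE X : X \in fam a ->
    gain a X (B, S) <= ((a \in chosen B S) && isolated B a X)%:R.
  move=> Xa; rewrite /gain /= !sub1set.
  set s1 := \sum_(z in Z a X) _; set s2 := \sum_(b in back a) _.
  have s10 : 0 <= s1.
    by apply: sumr_ge0 => z _; rewrite mulr_ge0 ?ler0n.
  have s20 : 0 <= s2.
    apply: sumr_ge0 => b _; apply: sumr_ge0 => Y _.
    by rewrite mulr_ge0 ?ler0n.
  have rhs0 (c : bool) : 0 <= c%:R :> R by rewrite ler0n.
  have [XB|XB] := boolP (X \subset B); last first.
    by rewrite mul0r; have := rhs0 ((a \in chosen B S) && isolated B a X); lra.
  have [aS|aS] := boolP (a \in S); last first.
    by rewrite mulr0; have := rhs0 ((a \in chosen B S) && isolated B a X); lra.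
  rewrite mulr1.
  case: (boolP (_ && _)) => [_|]; first by rewrite /=; lra.
  rewrite negb_and => H; rewrite -addrA -opprD subr_le0.
  have [iso|] := boolP (isolated B a X); last first.
    rewrite /isolated Xa XB /= => /pred0Pn[z /andP[/= zZ zB]].
    rewrite -[1]addr0; apply: lerD => //.
    rewrite /s1 (bigD1 z) //= subUset sub1set zB XB aS mulr1 lerDl.
    by apply: sumr_ge0 => ? _; rewrite mulr_ge0 ?ler0n.
  move: H; rewrite iso orbF inE aW aS /=.
  have -> : [exists X0, isolated B a X0] by apply/existsP; exists X.
  rewrite /= negb_forall => /existsP[b]; rewrite negb_imply negbK.
  case/andP=> ba /andP[bS /existsP[Y /andP[Yb YB]]].
  rewrite -[1]add0r; apply: lerD => //.
  rewrite /s2 (bigD1 b) //= (bigD1 Y) //= !subUset !sub1set XB YB aS bS mulr1.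
  rewrite -addrA lerDl addr_ge0 //.
    by apply: sumr_ge0 => ? _; rewrite mulr_ge0 ?ler0n.
  apply: sumr_ge0 => ? _; apply: sumr_ge0 => ? _.
  by rewrite mulr_ge0 ?ler0n.
apply: le_trans (ler_sum _ gainE) _.
have [ach|_] := boolP (a \in chosen B S); last by rewrite big1.
rewrite /=.
have [/existsP[X iX]|/existsPn nX] := boolP [exists X, isolated B a X]; last first.
  by rewrite big1 // => X _; rewrite (negPf (nX X)).
have uX Y : isolated B a Y -> Y = X.
  have sub X1 X2 : isolated B a X1 -> isolated B a X2 -> X1 \subset X2.
    case/and3P=> X1a X1B _ /and3P[X2a _ dZ].
    apply/subsetP => x x1; have := subsetP (famZ aW X2a X1a) x x1.
    case/setUP=> // xZ.
    by have := disjointFr dZ xZ; rewrite (subsetP X1B).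
  by move=> iY; apply/eqP; rewrite eqEsubset !sub.
rewrite (bigD1 X) /=; last by case/and3P: iX.
rewrite iX big1 ?addr0 // => Y /andP[_ /eqP YX].
by case iY: (isolated B a Y) => //; case: YX; apply: uX.
Qed.

Hypotheses (d0 : (0 < d)%N) (t0 : (0 < t)%N) (W0 : W != set0).
Hypothesis rho01 : forall a, 0 <= rho a <= 1.
(* With this choice of [rho] the expected number of pairs [(a, X)] with [X]
   inside [B] and [a] in [S] is [1 / (8 d)] for every [a]. *)
Hypothesis rhoE : forall a, a \in W ->
  (8 * d)%:R * (#|fam a|%:R * q ^+ t * rho a) = 1.
Hypothesis fam_card : forall a X, a \in W -> X \in fam a -> #|X| = t.
Hypothesis Z_disj : forall a X, a \in W -> X \in fam a ->
  [disjoint Z a X & X].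
Hypothesis Z_card : forall a X, a \in W -> X \in fam a ->
  (#|Z a X| <= 2 * t * d)%N.
Hypothesis back_irr : forall a, a \notin back a.
(* Given that [X] lies in [B], the expected number of active out-neighbours of
   [a] is at most 1/4. *)
Hypothesis overlap : forall a X, a \in W -> X \in fam a ->
  \sum_(b in back a) rho b * (\sum_(Y in fam b) q ^+ #|Y :\: X|) <= 4^-1.

Let q0 : 0 < q.
Proof. by rewrite invr_gt0 ltr0n !muln_gt0 t0 d0. Qed.

(** The spoilers cost a fraction at most [2 t d q = 1/8] and the active
    out-neighbours a fraction at most 1/4. *)
Lemma expect_gain a X : a \in W -> X \in fam a ->
  5 / 8 * (q ^+ t * rho a) <= expect (bern2 q rho) (gain a X).
Proof.
move=> aW Xa; rewrite /gain !expectB !expect_sum.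
rewrite expect_superset big_set1 (fam_card aW Xa).
have r0 : 0 <= q ^+ t * rho a.
  by case/andP: (rho01 a) => ? _; rewrite mulr_ge0 // exprn_ge0 // ltW.
have e1 : \sum_(z in Z a X) expect (bern2 q rho) (fun BS : {set T} * {set T} =>
    (z |: X \subset BS.1)%:R * ([set a] \subset BS.2)%:R)
    <= 8^-1 * (q ^+ t * rho a).
  rewrite (eq_bigr (fun=> q * (q ^+ t * rho a))); last first.
    move=> z zZ; rewrite expect_superset big_set1 cardsU1 (fam_card aW Xa).
    by rewrite (disjointFr (Z_disj aW Xa)) // add1n exprS mulrA.
  rewrite sumr_const -[leLHS]mulr_natl mulrA ler_wpM2r //.
  have : #|Z a X|%:R * q <= (2 * t * d)%:R * q.
    by rewrite ler_wpM2r ?ler_nat ?Z_card // ltW.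
  move=> Zq; apply: le_trans Zq _.
  have : (16 * t * d)%:R * q = 1.
    by rewrite mulfV // pnatr_eq0 -lt0n !muln_gt0 t0.
  by rewrite !natrM; lra.
have e2 : \sum_(b in back a) expect (bern2 q rho) (fun BS : {set T} * {set T} =>
    \sum_(Y in fam b)
    (X :|: Y \subset BS.1)%:R * ([set a; b] \subset BS.2)%:R)
    <= 4^-1 * (q ^+ t * rho a).
  rewrite mulrC; apply: le_trans (ler_wpM2l r0 (overlap aW Xa)).
  rewrite mulr_sumr; apply: ler_sum => b ba; rewrite expect_sum !mulr_sumr.
  apply: ler_sum => Y Yb; rewrite expect_superset.
  have ab : a != b by apply: contraTneq ba => <-.
  rewrite big_setU1 ?inE //= big_set1.
  have -> : X :|: Y = X :|: (Y :\: X).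
    by apply/setP => x; rewrite !inE; case: (x \in X).
  rewrite cardsU (fam_card aW Xa).
  have -> : X :&: (Y :\: X) = set0.
    by apply/setP => x; rewrite !inE; case: (x \in X).
  by rewrite cards0 subn0 exprD le_eqVlt; apply/orP; left; apply/eqP; ring.
lra.
Qed.

(** Each vertex of [W] is chosen with probability at least [5 / (64 d)], and lies
    in [B] with probability only [q = 1 / (16 t d)]. *)
Lemma exists_sample : exists B S : {set T}, (#|B :&: W| < #|chosen B S|)%N.
Proof.
pose f (BS : {set T} * {set T}) : R := \sum_(a in W)
  (\sum_(X in fam a) gain a X BS
   - ([set a] \subset BS.1)%:R * (set0 \subset BS.2)%:R).
have q1 : q <= 1.
  by rewrite invf_le1 ?ler1n ?ltr0n ?muln_gt0 ?t0 ?d0.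
have p0 BS : 0 <= bern2 q rho BS.
  by rewrite mulr_ge0 ?bern_ge0 // => _; rewrite q1 ltW.
have ef : 0 < expect (bern2 q rho) f.
  rewrite /f expect_sum.
  have ha a : a \in W -> 0 < expect (bern2 q rho) (fun BS =>
      (\sum_(X in fam a) gain a X BS
   - ([set a] \subset BS.1)%:R * (set0 \subset BS.2)%:R)).
    move=> aW; rewrite expectB expect_sum expect_superset big_set0 cards1 mulr1.
    have : \sum_(X in fam a) 5 / 8 * (q ^+ t * rho a) <=
           \sum_(X in fam a) expect (bern2 q rho) (gain a X).
      by apply: ler_sum => X; apply: expect_gain.
    rewrite expr1 subr_gt0; apply: lt_le_trans.
    rewrite sumr_const -[ltRHS]mulr_natl.
    have := rhoE aW; have : (16 * t * d)%:R * q = 1.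
      by rewrite mulfV // pnatr_eq0 -lt0n !muln_gt0 t0.
    rewrite !natrM => e1 e2.
    have d1 : 1 <= d%:R :> R by rewrite ler1n.
    have t1 : 1 <= t%:R :> R by rewrite ler1n.
    set N := #|fam a|%:R in e2 *; set Q := q ^+ t in e2 *.
    have e3 : 16 * (d%:R * q) <= 1.
      have dq : 0 <= d%:R * q by rewrite mulr_ge0 // ltW.
      have := ler_wpM2r dq t1; lra.
    rewrite -(ltr_pM2l (x := d%:R)) ?ltr0n //.
    rewrite (_ : _ * (N * _) = 5 / 64 * (8%:R * d%:R * (N * Q * rho a))).
      by rewrite e2; lra.
    by field.
  case/set0Pn: W0 => a aW; rewrite (bigD1 a) //=.
  apply: ltr_wpDr; last exact: ha.
  by apply: sumr_ge0 => b /andP[bW _]; apply/ltW/ha.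
have [[B S] /= fBS] := expect_pos p0 ef; exists B, S.
rewrite -(ltr_nat R) -subr_gt0; apply: lt_le_trans fBS _.
rewrite /f sumrB /= lerB //.
  have chW : chosen B S \subset W by apply/subsetP => a; rewrite inE => /andP[].
  rewrite -sum1_card natr_sum [leRHS]big_mkcond /=.
  rewrite [leLHS]big_mkcond /=; apply: ler_sum => a _.
  case: ifP => aW; last by case: ifP.
  apply: le_trans (sum_gain_le (B, S) aW) _.
  by case: (a \in _).
rewrite -sum1_card natr_sum [leLHS]big_mkcond [leRHS]big_mkcond /=.
apply: ler_sum => a _; rewrite inE sub0set sub1set mulr1.
by case: (a \in W); case: (a \in B).
Qed.

End Sampling.

(** * Degeneracy and stable sets *)

Section Degrees.
Variable G : sgraph.
Implicit Types (x y a : G) (U W X : {set G}).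

Definition nbhd x : {set G} := [set y | adj x y].

Definition degin W x := #|W :&: nbhd x|.

Definition stable X := [forall x in X, forall y in X, ~~ adj x y].

Definition degenerate k W := forall U, U \subset W -> U != set0 ->
  exists2 x, x \in U & degin U x <= k.

Lemma stableP X :
  reflect {in X &, forall x y, ~~ adj x y} (stable X).
Proof.
apply: (iffP forall_inP) => H x => [y xX yX|xX].
  exact: (forall_inP (H x xX)).
by apply/forall_inP => y yX; apply: H.
Qed.

Lemma degin_subset U W x : U \subset W -> degin U x <= degin W x.
Proof. by move=> UW; apply/subset_leq_card/setSI. Qed.

(** Remove a vertex of degree at most [k], orient the rest, and direct the
    edges at that vertex away from it. *)
Lemma orientation k W : degenerate k W ->
  exists back : G -> {set G},
    [/\ forall x, back x \subset W :&: nbhd x,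
        forall x, #|back x| <= k
      & {in W &, forall x y, adj x y -> (y \in back x) || (x \in back y)}].
Proof.
elim: {W}_.+1 {-2}W (ltnSn #|W|) => // n IH W Wn degW.
have [->|W0] := eqVneq W set0.
  exists (fun=> set0); split=> [x|x|x y]; rewrite ?sub0set ?cards0 //.
  by rewrite inE.
have [x xW dx] := degW W (subxx _) W0.
have [||back [backN backk backo]] := IH (W :\ x).
- by rewrite (cardsD1 x W) xW in Wn.
- by move=> U UW; apply: degW; apply: subset_trans UW (subD1set _ _).
exists (fun z => if z == x then W :&: nbhd x else back z); split.
- move=> z; case: eqP => [->//|_]; apply: subset_trans (backN z) _.
  by apply/setSI/subD1set.
- by move=> z; case: ifP.
move=> y z yW zW yz.
case: (eqVneq y x) => yx.
  by rewrite inE zW inE -yx yz.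
case: (eqVneq z x) => zx; first by rewrite !inE yW -zx adj_sym yz orbT.
by apply: backo; rewrite // !inE ?yx ?zx.
Qed.

(** Every edge is counted at its tail and at its head, and there are at most
    [k] edges per tail. *)
Lemma sum_degin_le k W : degenerate k W ->
  \sum_(x in W) degin W x <= 2 * k * #|W|.
Proof.
move=> /orientation[back [backN backk backo]].
have h x : x \in W -> degin W x <= #|back x| + \sum_(y in W) (x \in back y).
  move=> xW; have -> : \sum_(y in W) (x \in back y) =
            #|[set y in W | x \in back y]|.
    rewrite -sum1_card [RHS]big_mkcond [LHS]big_mkcond /=.
    by apply: eq_bigr => y _; rewrite inE; case: (y \in W); case: (x \in _).
  apply: leq_trans (leq_card_setU _ _); apply/subset_leq_card/subsetP => y.
  rewrite !inE => /andP[yW xy]; rewrite yW /=; exact: backo.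
apply: (@leq_trans (\sum_(x in W) (#|back x| + \sum_(y in W) (x \in back y)))).
  exact: leq_sum.
rewrite big_split /= exchange_big /=.
have h2 : \sum_(x in W) #|back x| <= k * #|W|.
  by rewrite mulnC -sum_nat_const; apply: leq_sum.
have h3 : \sum_(j in W) \sum_(i in W) (i \in back j) <= k * #|W|.
  apply: leq_trans h2; apply: leq_sum => y yW.
  rewrite -[leqRHS]sum1_card [leqLHS]big_mkcond [leqRHS]big_mkcond.
  by apply: leq_sum => x _; case: (x \in W); case: (x \in back y).
by rewrite -mulnA mul2n -addnn leq_add.
Qed.

Lemma dense_subset k W :
  2 * k * #|W| < \sum_(x in W) degin W x ->
  exists U, [/\ U \subset W, U != set0 & {in U, forall x, k < degin U x}].
Proof.
move=> dW.
have [/exists_inP[U UW /andP[U0 /forall_inP dU]]|H] :=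
  boolP [exists (U : {set G} | U \subset W),
     (U != set0) && [forall x in U, k < degin U x]].
  by exists U.
suff /sum_degin_le : degenerate k W by rewrite leqNgt dW.
move=> U UW U0; move: H; rewrite negb_exists_in => /forall_inP/(_ U UW).
rewrite U0 /= negb_forall_in => /exists_inP[x xU].
by rewrite -leqNgt; exists x.
Qed.

Lemma leq_card_bigcup (T : finType) (A : {set T}) (F : T -> {set T}) :
  #|\bigcup_(i in A) F i| <= \sum_(i in A) #|F i|.
Proof.
elim/big_rec2: _ => [|i n B _ IH]; first by rewrite cards0.
by apply: leq_trans (leq_card_setU _ _) _; rewrite leq_add2l.
Qed.

Definition stable_sets X j :=
  [set T : {set G} | [&& T \subset X, #|T| == j & stable T]].

(** Double counting of the pairs of a stable [j]-set and a vertex extending it: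
    a stable [j]-set excludes at most [j * D.+1] vertices. *)
Lemma stable_sets_step D X j : {in X, forall x, degin X x <= D} ->
  #|stable_sets X j| * (#|X| - j * D.+1) <= #|stable_sets X j.+1| * j.+1.
Proof.
move=> degX.
pose P := [set p : {set G} * G | [&& p.1 \in stable_sets X j, p.2 \in X,
  p.2 \notin p.1 & stable (p.2 |: p.1)]].
pose Q := [set p : {set G} * G | (p.1 \in stable_sets X j.+1) && (p.2 \in p.1)].
have cQ : #|Q| = #|stable_sets X j.+1| * j.+1.
  rewrite -sum1_card (eq_bigl (fun p => (p.1 \in stable_sets X j.+1) &&
    (p.2 \in p.1))); last by move=> p; rewrite inE.
  rewrite -(pair_big_dep (fun T => T \in stable_sets X j.+1)
    (fun (T : {set G}) x => x \in T) (fun _ _ => 1)) /=.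
  rewrite -sum_nat_const; apply: eq_bigr => T; rewrite inE sum1_card.
  by case/and3P=> _ /eqP <-.
rewrite -cQ; apply: (@leq_trans #|P|); last first.
  rewrite -(card_in_imset (D := mem P)
    (f := fun p : {set G} * G => (p.2 |: p.1, p.2))); last first.
    move=> [T x] [T' x']; rewrite !inE /= => /and4P[_ _ xT _] /and4P[_ _ xT' _].
    by case=> TT xx; rewrite -xx in TT xT' *; rewrite -(setU1K xT) TT setU1K.
  apply/subset_leq_card/subsetP => _ /imsetP[[T x] pP ->].
  move: pP; rewrite !inE /= => /and4P[/and3P[TX /eqP Tj _] xX xT st].
  by rewrite subUset sub1set xX TX cardsU1 xT Tj st add1n !eqxx.
have cP : #|P| = \sum_(T in stable_sets X j)
    #|[set x | [&& x \in X, x \notin T & stable (x |: T)]]|.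
  rewrite -sum1_card (eq_bigl (fun p => (p.1 \in stable_sets X j) &&
    (p.2 \in [set x | [&& x \in X, x \notin p.1 & stable (x |: p.1)]]))); last first.
    by move=> p; rewrite inE in_set.
  rewrite -(pair_big_dep (fun T => T \in stable_sets X j) (fun (T : {set G}) x =>
    x \in [set x | [&& x \in X, x \notin T & stable (x |: T)]]) (fun _ _ => 1)) /=.
  by apply: eq_bigr => T _; rewrite sum1_card.
rewrite cP -sum_nat_const; apply: leq_sum => T; rewrite inE.
case/and3P=> TX /eqP Tj /stableP sT.
set A := [set _ | _]; rewrite leq_subLR.
have cover : X \subset (\bigcup_(y in T) (y |: (X :&: nbhd y))) :|: A.
  apply/subsetP => x xX; rewrite inE; case: bigcupP => //= nx.
  rewrite inE xX /=; have xT : x \notin T.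
    by apply/negP => xT; apply: nx; exists x; rewrite ?setU11.
  have nxT y : y \in T -> ~~ adj y x.
    move=> yT; apply/negP => yx; apply: nx; exists y; rewrite // !inE xX yx.
    by rewrite orbT.
  rewrite xT; apply/stableP => y z /setU1P[->|yT] /setU1P[->|zT].
  - by rewrite adj_irr.
  - by rewrite adj_sym nxT.
  - exact: nxT.
  - exact: sT.
apply: leq_trans (subset_leq_card cover) _.
apply: leq_trans (leq_card_setU _ _) _; rewrite leq_add2r.
apply: leq_trans (leq_card_bigcup _ _) _.
rewrite -Tj -sum_nat_const; apply: leq_sum => y yT.
rewrite cardsU1 -(add1n D) leq_add ?leq_b1 // degX //.
exact: (subsetP TX).
Qed.

Lemma card_stable_sets D X j : {in X, forall x, degin X x <= D} ->
  (#|X| - j * D.+1) ^ j <= #|stable_sets X j| * j ^ j.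
Proof.
move=> degX; suff : forall i, i <= j ->
    (#|X| - j * D.+1) ^ i <= #|stable_sets X i| * j ^ i by apply.
elim=> [_|i IH ij].
  rewrite !expn0 muln1 card_gt0; apply/set0Pn; exists set0.
  rewrite inE sub0set cards0 eqxx; apply/stableP => x y.
  by rewrite inE.
have := stable_sets_step i degX.
have := IH (ltnW ij).
set A := #|X| - j * D.+1; set B := #|X| - _ => h1 h2.
have AB : A <= B by rewrite leq_sub2l // leq_mul2r ltnW ?orbT.
rewrite expnSr; apply: leq_trans (leq_mul h1 AB) _.
rewrite mulnAC; apply: leq_trans (leq_mul h2 (leqnn _)) _.
rewrite expnS -!mulnA leq_mul2l leq_mul2r ij !orbT //.
Qed.

End Degrees.

(** * Graphs with sparse neighbourhoods *)

(** Here [(64 * t) ^ (2 * t)] is [64 ^ t] times [(64 * t ^ 2) ^ t], and the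
    inverse of the latter bounds from below the expected number of members of
    [fam a] inside [B]; the factor [64 ^ t] absorbs [16 * t * 2 ^ t]. *)
Lemma step_bound e t : 0 < t -> 0 < e ->
  [/\ 4 * t * (8 * e).+1 <= e * (64 * t) ^ (2 * t),
      (64 * t ^ 2) ^ t <= e * (64 * t) ^ (2 * t) &
      t * (8 * e) * ((64 * t ^ 2) ^ t * 2 ^ t.+1) <= e * (64 * t) ^ (2 * t)].
Proof.
move=> t0 e0.
have E : (64 * t) ^ (2 * t) = (64 * t ^ 2) ^ t * 64 ^ t.
  by rewrite expnM -expnMn; congr (_ ^ t); ring.
have h : 16 * t * 2 ^ t <= 64 ^ t.
  rewrite (_ : 64 ^ t = 16 ^ t * 2 ^ t * 2 ^ t); last by rewrite -!expnMn.
  by rewrite leq_mul2r leq_mul ?orbT // ?(ltnW (ltn_expl _ _)) // -{1}(expn1 16) leq_pexp2l.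
have p0 : 0 < (64 * t ^ 2) ^ t by rewrite expn_gt0 muln_gt0 expn_gt0 t0.
split.
- have : (64 * t) ^ 2 <= (64 * t) ^ (2 * t).
    by rewrite leq_pexp2l ?muln_gt0 ?t0 // leq_pmulr.
  move=> h2; apply: leq_trans (leq_mul (leqnn e) h2); nia.
- by rewrite E mulnCA leq_pmulr // muln_gt0 e0 expn_gt0.
rewrite E (expnS 2 t); set M := (64 * t ^ 2) ^ t in p0 *.
rewrite (_ : _ * _ = e * (M * (16 * t * 2 ^ t))); last by ring.
by rewrite !leq_mul.
Qed.

Lemma card_low_degree (G : sgraph) (U N : {set G}) e d :
  N \subset U -> #|U| <= 2 * d -> d <= #|N| -> 0 < e -> degenerate e U ->
  d <= 2 * #|[set b in N | degin U b <= 8 * e]|.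
Proof.
move=> NU Ud dN e0 /sum_degin_le dU.
have E : #|N| = #|[set b in N | degin U b <= 8 * e]| +
             #|[set b in N | 8 * e < degin U b]|.
  rewrite -(cardsID [set b | degin U b <= 8 * e] N); congr (_ + _).
    by apply: eq_card => b; rewrite !inE.
  by apply: eq_card => b; rewrite !inE -ltnNge andbC.
have : #|[set b in N | 8 * e < degin U b]| * (8 * e) <= 4 * e * d.
  rewrite -sum_nat_const.
  apply: (@leq_trans (\sum_(x in U) degin U x)); last first.
    apply: leq_trans dU _; rewrite (_ : 4 * e * d = 2 * e * (2 * d)); last by ring.
    by rewrite leq_mul2l Ud orbT.
  rewrite [leqLHS]big_mkcond [leqRHS]big_mkcond; apply: leq_sum => x _.
  rewrite inE; case: (boolP (x \in N)) => xN //=.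
  by rewrite (subsetP NU) //; case: ltnP => // /ltnW.
nia.
Qed.

(** The sparsity of neighbourhoods is used twice.  It makes most of the [d]
    neighbours of [a] eligible for [N2 a], so that they contain about as many
    stable [t]-sets as there are [t]-sets; and it makes an eligible vertex
    adjacent to few out-neighbours of [a], so that for most of these the event
    of being active is independent of the event that a given witness for [a]
    lies in [B]. *)
Lemma sparse_nbhds_stable_pair (G : sgraph) (W : {set G}) (e d t : nat) :
  0 < t -> 0 < e -> W != set0 ->
  {in W, forall x, d <= degin W x} -> degenerate d W ->
  {in W, forall a, degenerate e (W :&: nbhd a)} ->
  e * (64 * t) ^ (2 * t) <= d ->
  exists F B : {set G}, [/\ F \subset W, stable F, stable B, #|B| < #|F| &
                            {in F, forall a, t <= degin B a}].
Proof.
move=> t0 e0 W0 degW /orientation[back [backN backd backo]] sparse ed.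
have [b1 b2 b3] := step_bound t0 e0.
have {}b1 := leq_trans b1 ed; have {}b2 := leq_trans b2 ed.
have {}b3 := leq_trans b3 ed.
have d0 : 0 < d by apply: leq_trans b1; rewrite !muln_gt0 t0.
(* truncating to [d] neighbours keeps the expected size of [N a :&: B] small,
   however large the degree of [a] is *)
pose N a : {set G} := [set:: take d (enum (W :&: nbhd a))].
have NW a : N a \subset W :&: nbhd a.
  by apply/subsetP => x; rewrite inE => /mem_take; rewrite mem_enum.
have Ncard a : #|N a| = minn d (degin W a).
  rewrite cardsE (card_uniqP _) ?take_uniq ?enum_uniq //.
  by rewrite size_take_min -cardE.
have Nle a : #|N a| <= d by rewrite Ncard geq_minl.
have Nd a : a \in W -> #|N a| = d by move=> aW; rewrite Ncard; apply/minn_idPl/degW.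
pose U a := back a :|: N a.
pose N2 a := [set b in N a | degin (U a) b <= 8 * e].
have N2N a : N2 a \subset N a by apply/subsetP => b; rewrite inE => /andP[].
have UW a : U a \subset W :&: nbhd a by rewrite subUset backN NW.
have N2d a : a \in W -> d <= 2 * #|N2 a|.
  move=> aW; apply: card_low_degree; rewrite ?subsetUr ?Nd //.
    apply: leq_trans (leq_card_setU _ _) _.
    by rewrite mul2n -addnn leq_add.
  move=> V VU; apply: sparse aW _ _; exact: subset_trans VU (UW a).
pose fam a := stable_sets (N2 a) t.
have famP a X : X \in fam a -> [/\ X \subset N2 a, #|X| = t & stable X].
  by rewrite inE => /and3P[? /eqP].
have fam_card a : a \in W -> d ^ t <= #|fam a| * (4 * t) ^ t.
  move=> aW; have : {in N2 a, forall x, degin (N2 a) x <= 8 * e}.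
    move=> x; rewrite inE => /andP[_]; apply: leq_trans; apply: degin_subset.
    by apply: subset_trans (N2N a) _; rewrite subsetUr.
  move=> /(@card_stable_sets _ _ _ t) h.
  apply: (@leq_trans (4 ^ t * (#|N2 a| - t * (8 * e).+1) ^ t)).
    rewrite -expnMn leq_exp2r //; have := N2d a aW; nia.
  by rewrite expnMn mulnCA leq_mul2l h orbT.
pose Z a (X : {set G}) := (N a :|: \bigcup_(b in X) back b) :\: X.
pose q : rat := ((16 * t * d)%:R^-1)%R.
(* [back], hence the blocking, never leaves [W]: outside it [rho] can be 0 *)
pose rho a : rat :=
  (if a \in W then ((8 * d)%:R * (#|fam a|%:R * q ^+ t))^-1 else 0)%R.
pose M : rat := ((64 * t ^ 2) ^ t)%:R%R.
have q0 : (0 < q)%R by rewrite invr_gt0 ltr0n !muln_gt0 t0 d0.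
have qE : ((16 * t * d)%:R * q = 1)%R.
  by rewrite mulfV // pnatr_eq0 -lt0n !muln_gt0 t0.
have M0 : (0 < M)%R by rewrite ltr0n expn_gt0 muln_gt0 expn_gt0 t0.
have pM a : a \in W -> (1 <= #|fam a|%:R * q ^+ t * M)%R.
  move=> aW.
  have dt : (0 < d%:R ^+ t :> rat)%R by rewrite exprn_gt0 ?ltr0n.
  rewrite -(ler_pM2l dt) mulr1.
  suff -> : (d%:R ^+ t * (#|fam a|%:R * q ^+ t * M) = (#|fam a| * (4 * t) ^ t)%:R)%R.
    by rewrite -natrX ler_nat fam_card.
  have -> : (M = (64 * t%:R ^+ 2) ^+ t)%R by rewrite /M natrX natrM natrX.
  rewrite natrM natrX natrM mulrCA -!mulrA -!exprMn.
  congr (_ * _ ^+ t)%R.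
  by move: qE; rewrite !natrM => qE; rewrite -[RHS]mulr1 -[X in (_ = _ * X)%R]qE; ring.
have pf a : a \in W -> (0 < #|fam a|%:R * q ^+ t :> rat)%R.
  by move=> /pM h; have := lt_le_trans ltr01 h; rewrite pmulr_lgt0.
have d0' : (0 < (8 * d)%:R :> rat)%R by rewrite ltr0n muln_gt0.
have rho0 a : (0 <= rho a)%R.
  rewrite /rho; case: ifP => // aW.
  by rewrite invr_ge0 mulr_ge0 ?ler0n // ltW // pf.
have rhoE a : a \in W -> ((8 * d)%:R * (#|fam a|%:R * q ^+ t * rho a) = 1)%R.
  move=> aW; rewrite /rho aW mulrA mulfV //.
  by rewrite mulf_neq0 // gt_eqF // pf.
have rhoM a : ((8 * d)%:R * rho a <= M)%R.
  have [aW|aW] := boolP (a \in W); last by rewrite /rho (negPf aW) mulr0 ltW.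
  have := ler_wpM2l (rho0 a) (pM a aW); have := rhoE a aW.
  rewrite mulr1; set r := rho a; set p := (_ * q ^+ t)%R; move=> h1 h2.
  have h3 : ((8 * d)%:R * r <= (8 * d)%:R * (r * (p * M)))%R by rewrite ler_pM2l.
  apply: le_trans h3 _.
  have -> : ((8 * d)%:R * (r * (p * M)) = (8 * d)%:R * (p * r) * M)%R by ring.
  by rewrite h1 mul1r.
have rho1 a : (rho a <= 1)%R.
  rewrite -(ler_pM2l d0') mulr1; apply: le_trans (rhoM a) _.
  rewrite /M ler_nat; lia.
have overlap a X : a \in W -> X \in fam a ->
  (\sum_(b in back a) rho b * (\sum_(Y in fam b) q ^+ #|Y :\: X|) <= 4^-1)%R.
  move=> aW Xa; have [XN Xt _] := famP a X Xa.
  (* If [N b] misses [X], then the two events are independent and [b] contributes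
     at most 1/(8d); otherwise [sum_pow_superset] costs a factor [M * 2^(t+1)],
     for at most [t * (8 * e)] vertices [b]. *)
  pose meet b := ~~ [disjoint N b & X].
  have term b : b \in back a ->
    (rho b * (\sum_(Y in fam b) q ^+ #|Y :\: X|) <=
     (8 * d)%:R^-1 + (meet b)%:R * (M * 2 ^+ t.+1 * (8 * d)%:R^-1))%R.
    move=> ba; have bW : b \in W.
      by have := subsetP (backN a) b ba; rewrite inE => /andP[].
    have [mb|] := boolP (meet b).
      rewrite mul1r; apply: (@le_trans _ _ (M * 2 ^+ t.+1 * (8 * d)%:R^-1)%R).
        rewrite mulrAC; apply: ler_pM; rewrite ?rho0 //.
        - by apply: sumr_ge0 => Y _; rewrite exprn_ge0 // ltW.
        - by rewrite ler_pdivlMr // mulrC.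
        rewrite -Xt.
        apply: le_trans (sum_pow_superset X (ltW q0) (Nle b) _); last first.
          move: qE; rewrite !natrM => qE.
          have t1 : (1 <= t%:R :> rat)%R by rewrite ler1n.
          have dq : (0 <= d%:R * q)%R by rewrite mulr_ge0 // ltW.
          by have := ler_wpM2r dq t1; lra.
        rewrite [leLHS]big_mkcond [leRHS]big_mkcond; apply: ler_sum => Y _.
        have Y0 : (0 <= q ^+ #|Y :\: X|)%R by rewrite exprn_ge0 // ltW.
        case: ifP => [/famP[YN _ _]|_]; last by case: ifP.
        by rewrite (subset_trans YN (N2N b)).
      by rewrite lerDr invr_ge0 ltW.
    move=> /negbNE nm; rewrite mul0r addr0.
    rewrite (eq_bigr (fun=> q ^+ t)%R); last first.
      move=> Y /famP[YN Yt _]; congr (_ ^+ _)%R; rewrite -Yt; apply: eq_card => y.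
      rewrite inE; case yY: (y \in Y); rewrite ?andbF // andbT.
      by rewrite (disjointFr nm) // (subsetP (N2N b)) // (subsetP YN).
    rewrite sumr_const -[(q ^+ t *+ _)%R]mulr_natl.
    rewrite -(ler_pM2l d0') mulfV ?gt_eqF //.
    by rewrite [(rho b * _)%R]mulrC rhoE.
  have meetc : \sum_(b in back a) meet b <= t * (8 * e).
    have -> : \sum_(b in back a) meet b = #|[set b in back a | meet b]|.
      rewrite -sum1_card [RHS]big_mkcond [LHS]big_mkcond.
      by apply: eq_bigr => b _; rewrite inE; case: (b \in back a); case: (meet b).
    have sub : [set b in back a | meet b] \subset \bigcup_(x in X) (U a :&: nbhd x).
      apply/subsetP => b; rewrite inE => /andP[ba /pred0Pn[x /andP[/= xN xX]]].
      apply/bigcupP; exists x => //; rewrite !inE ba /= adj_sym.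
      by have := subsetP (NW b) x xN; rewrite !inE => /andP[].
    apply: leq_trans (subset_leq_card sub) _.
    apply: leq_trans (leq_card_bigcup _ _) _.
    rewrite -Xt -sum_nat_const; apply: leq_sum => x xX.
    by have := subsetP XN x xX; rewrite inE => /andP[].
  apply: le_trans (ler_sum _ term) _.
  rewrite big_split /= sumr_const -mulr_suml -natr_sum.
  rewrite -[((8 * d)%:R^-1 *+ _)%R]mulr_natl.
  have h1 : (#|back a|%:R * (8 * d)%:R^-1 <= 8^-1 :> rat)%R.
    rewrite ler_pdivrMr // natrM mulKf // ?ler_nat //.
  have h2 : ((\sum_(b in back a) meet b)%:R *
             (M * 2 ^+ t.+1 * (8 * d)%:R^-1) <= 8^-1 :> rat)%R.
    rewrite mulrA ler_pdivrMr // [((8 * d)%:R)%R]natrM mulKf //.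
    rewrite /M -natrX -!natrM ler_nat; apply: leq_trans b3.
    by rewrite leq_mul2r meetc orbT.
  lra.
have [||||||B [S BS]] := @exists_sample rat G W d t rho back fam Z _ d0 t0 W0 _ rhoE _ _ _ _ overlap.
- move=> a X Y aW _ /famP[YN _ _]; apply/subsetP => y yY.
  rewrite in_setU in_setD in_setU; case: (y \in X) => //=.
  by rewrite (subsetP (N2N a)) ?(subsetP YN).
- by move=> a; rewrite rho0 rho1.
- by move=> a X _ /famP[].
- move=> a X _ _; apply/pred0Pn => -[x /andP[/=]].
  by rewrite inE => /andP[/negPf->].
- move=> a X aW /famP[_ Xt _]; apply: leq_trans (subset_leq_card (subsetDl _ _)) _.
  apply: leq_trans (leq_card_setU _ _) _.
  have : #|\bigcup_(b in X) back b| <= t * d.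
    apply: leq_trans (leq_card_bigcup _ _) _.
    by rewrite -Xt -sum_nat_const; apply: leq_sum.
  by have := Nle a; nia.
- move=> a; apply/negP => /(subsetP (backN a)).
  by rewrite !inE adj_irr andbF.
pose B' := [set b in B :&: W | [disjoint back b & B]].
exists (chosen W back fam Z B S), B'; split.
- by apply/subsetP => a; rewrite inE => /andP[].
- have chP a b : a \in chosen W back fam Z B S ->
      b \in chosen W back fam Z B S -> b \notin back a.
    rewrite !inE => /and4P[_ _ _ /forall_inP ab].
    move=> /and4P[_ bS /existsP[X /and3P[Xb XB _]] _].
    apply/negP => /ab; rewrite /active bS /=; case/exists_inP.
    by exists X.
  apply/stableP => a b aF bF; apply/negP => /backo.
  have iW c : c \in chosen W back fam Z B S -> c \in W by rewrite inE => /andP[].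
  rewrite !iW // => /(_ isT isT).
  by rewrite (negPf (chP _ _ aF bF)) (negPf (chP _ _ bF aF)).
- have bP a b : a \in B' -> b \in B' -> b \notin back a.
    rewrite !inE => /andP[_ dj] /andP[/andP[bB _] _].
    by rewrite (disjointFl dj).
  apply/stableP => a b aF bF; apply/negP => /backo.
  have iW c : c \in B' -> c \in W by rewrite !inE => /andP[/andP[]].
  rewrite !iW // => /(_ isT isT).
  by rewrite (negPf (bP _ _ aF bF)) (negPf (bP _ _ bF aF)).
- apply: leq_ltn_trans BS; apply/subset_leq_card/subsetP => b.
  by rewrite inE => /andP[].
move=> a; rewrite inE => /and4P[aW _ /existsP[X /and3P[Xa XB dj]] _].
have [XN Xt /stableP sX] := famP a X Xa.
rewrite -Xt; apply/subset_leq_card/subsetP => x xX.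
have xN : x \in W :&: nbhd a.
  by apply: (subsetP (NW a)); apply: (subsetP (N2N a)); apply: (subsetP XN).
case/setIP: xN => xW xa; rewrite !in_setI xa in_set !in_setI xW (subsetP XB) //= andbT.
apply/pred0Pn => -[y /andP[/= yx yB]].
have xy : adj x y by have := subsetP (backN x) y yx; rewrite !inE => /andP[].
have yX : y \notin X by apply: contraL xy; apply: sX.
have : y \in Z a X.
  by rewrite in_setD yX in_setU; apply/orP; right; apply/bigcupP; exists x.
by move=> /(disjointFr dj); rewrite yB.
Qed.

(** * Clique-free graphs *)

Definition clique (G : sgraph) (C : {set G}) :=
  {in C &, forall x y, x != y -> adj x y}.

Definition bipartite_core (G : sgraph) (k : nat) (U A : {set G}) :=
  [/\ U != set0, {in U &, forall x y, adj x y -> (x \in A) != (y \in A)} &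
      {in U, forall x, k <= degin U x}].

(** The value [(64 * t) ^ (2 * t)] at [t = 4 * k]: the factor by which the
    minimum degree must exceed the degeneracy of the neighbourhoods. *)
Definition threshold k := (256 * k) ^ (8 * k).

(** The set [F :|: B] has fewer than [2 * #|F|] vertices and degree sum at least
    [4 * k * #|F|], so its average degree exceeds [2 * k]. *)
Lemma bipartite_core_of_pair (G : sgraph) (k : nat) (F B : {set G}) :
  0 < k -> stable F -> stable B -> #|B| < #|F| ->
  {in F, forall a, 4 * k <= degin B a} -> exists U, bipartite_core k U F.
Proof.
move=> k0 /stableP sF /stableP sB BF dF.
have [|U [UFB U0 dU]] := @dense_subset G k.-1 (F :|: B).
  apply: (@leq_trans (4 * k * #|F|)).
    have : #|F :|: B| <= #|F| + #|B| by apply: leq_card_setU.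
    nia.
  rewrite mulnC -sum_nat_const [leqLHS]big_mkcond [leqRHS]big_mkcond /=.
  apply: leq_sum => a _; rewrite inE; case: (boolP (a \in F)) => //= aF.
  by apply: leq_trans (dF a aF) _; apply/degin_subset/subsetUr.
exists U; split=> // [x y xU yU xy|x xU]; last first.
  by rewrite -(prednK k0); apply: dU.
have := subsetP UFB x xU; have := subsetP UFB y yU; rewrite !inE.
have [xF|xF] := boolP (x \in F); have [yF|yF] := boolP (y \in F) => //=.
  by have := sF x y xF yF; rewrite xy.
by move=> yB xB; have := sB x y xB yB; rewrite xy.
Qed.

(** Induction on [s].  A subset of minimum degree [threshold k ^ s] inside the
    neighbourhood of a vertex [a] has no clique of size [s], since [a] would
    extend it.  Otherwise neighbourhoods are sparse, and the largest [D] such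
    that some subset [V] of [W] has minimum degree [D] makes [V] at the same
    time [D]-degenerate. *)
Lemma clique_free_bipartite_core (s k : nat) (G : sgraph) (W : {set G}) :
  0 < k -> W != set0 ->
  (forall C : {set G}, C \subset W -> #|C| = s -> ~ clique C) ->
  {in W, forall x, threshold k ^ s <= degin W x} ->
  exists U A : {set G}, bipartite_core k U A.
Proof.
move=> k0; elim: s W => [|s IH] W W0 freeW degW.
  case: (freeW set0); rewrite ?sub0set ?cards0 // => x y.
  by rewrite inE.
set e := threshold k ^ s.
have e0 : 0 < e by rewrite !expn_gt0 muln_gt0 k0.
have [/exists_inP[a aW /existsP[U]]|sparse] := boolP
  [exists a in W, exists U : {set G},
     [&& U \subset W :&: nbhd a, U != set0 & [forall x in U, e <= degin U x]]].
  rewrite subsetI => /and3P[/andP[UW Ua] U0 /forall_inP dU].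
  apply: (IH U) => // C CU Cs clC.
  have aC : a \notin C.
    apply/negP => aC; have := subsetP Ua a (subsetP CU a aC).
    by rewrite inE adj_irr.
  have aN x : x \in C -> adj a x.
    by move=> xC; have := subsetP Ua x (subsetP CU x xC); rewrite inE.
  apply: (freeW (a |: C)); first by rewrite subUset sub1set aW (subset_trans CU).
    by rewrite cardsU1 aC Cs.
  move=> x y /setU1P[->|xC] /setU1P[->|yC]; rewrite ?eqxx //.
  - by move=> _; apply: aN.
  - by move=> _; rewrite adj_sym; apply: aN.
  - exact: clC.
pose P D := [exists V : {set G},
  [&& V \subset W, V != set0 & [forall x in V, D <= degin V x]]].
have PW : P (threshold k ^ s.+1).
  by apply/existsP; exists W; rewrite subxx W0; apply/forall_inP.
have Pbound D : P D -> D <= #|G|.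
  case/existsP=> V /and3P[_ /set0Pn[x xV] /forall_inP/(_ x xV)/leq_trans]; apply.
  exact: max_card.
case: (ex_maxnP (ex_intro (fun D => P D) _ PW) Pbound) => D /existsP[V /and3P[VW V0 /forall_inP dV]] maxD.
have degV : degenerate D V.
  move=> U UV U0; apply/exists_inP; apply: contraT.
  rewrite negb_exists_in => /forall_inP dU.
  have := maxD D.+1; rewrite ltnn; apply; apply/existsP; exists U.
  rewrite (subset_trans UV VW) U0; apply/forall_inP => x xU.
  by rewrite ltnNge dU.
have sparseV : {in V, forall a, degenerate e (V :&: nbhd a)}.
  move=> a aV U UVa U0; apply/exists_inP; apply: contraNT sparse.
  rewrite negb_exists_in => /forall_inP dU.
  apply/exists_inP; exists a; first exact: (subsetP VW).
  apply/existsP; exists U; rewrite U0 (subset_trans UVa) ?setSI //=.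
  by apply/forall_inP => x xU; rewrite ltnW // ltnNge dU.
have [||F [B [_ sF sB BF dF]]] := @sparse_nbhds_stable_pair G V e D (4 * k) _ e0 V0 dV degV sparseV.
- by rewrite muln_gt0.
- rewrite !mulnA; apply: leq_trans (maxD _ PW).
  by rewrite expnSr.
by have [U] := bipartite_core_of_pair k0 sF sB BF dF; exists U, F.
Qed.

(** * Back to minimum degrees of induced subgraphs *)

Lemma min_degree_le (G : sgraph) (x : G) : min_degree G <= degree x.
Proof.
rewrite /min_degree; have : x \in index_enum G by rewrite mem_index_enum.
elim: (index_enum G) => // y r IH; rewrite inE big_cons => /orP[/eqP <-|xr].
  exact: geq_minl.
exact: leq_trans (geq_minr _ _) (IH xr).
Qed.

Lemma bipartite_core_induced (G : sgraph) (k : nat) (U A : {set G}) :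
  bipartite_core k U A ->
  [/\ U != set0, bipartite (induced U) & k <= min_degree (induced U)].
Proof.
case=> U0 bipU dU; split=> //.
  exists [set x : induced U | val x \in A] => x y xy; rewrite !inE.
  exact: bipU (valP x) (valP y) xy.
have degE (x : induced U) : degree x = degin U (val x).
  rewrite /degree -(card_imset _ val_inj); apply: eq_card => y.
  rewrite !inE; apply/imsetP/andP => [[z]|[yU xy]].
    by rewrite inE => xz ->; split=> //; apply: valP.
  by exists (Sub y yU : {x : G | x \in U}); rewrite // inE.
rewrite /min_degree; apply: (big_ind (fun m => k <= m)) => [|m n km kn|x _].
- case/set0Pn: U0 => x xU; apply: leq_trans (dU x xU) _.
  rewrite card_sig; apply/subset_leq_card/subsetP => y.
  by rewrite !inE => /andP[].
- by rewrite leq_min km.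
- by rewrite degE; apply/dU/valP.
Qed.

Lemma subgraph_free_clique (H G : sgraph) (C : {set G}) :
  subgraph_free H G -> #|C| = #|H| -> ~ clique C.
Proof.
move=> freeG CH clC; apply: freeG.
pose f h := enum_val (cast_ord (esym CH) (enum_rank h)).
have f_inj : injective f.
  by move=> x y /enum_val_inj/cast_ord_inj/enum_rank_inj.
exists f => // x y xy; apply: clC; rewrite ?enum_valP //.
by rewrite (inj_eq f_inj); apply: contraTneq xy => ->; rewrite adj_irr.
Qed.

Lemma edge_core (G : sgraph) : 0 < #|G| -> 0 < min_degree G ->
  exists U A : {set G}, bipartite_core 1 U A.
Proof.
move=> /card_gt0P[x _] dG.
have : 0 < degree x by apply: leq_trans dG (min_degree_le x).
case/card_gt0P=> y; rewrite inE => xy.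
have yx : y != x by apply: contraTneq xy => ->; rewrite adj_irr.
exists [set x; y], [set x]; split.
- by apply/set0Pn; exists x; rewrite set21.
- move=> a b /set2P[]-> /set2P[]->; rewrite ?adj_irr // !inE eqxx ?(negPf yx) //.
- move=> a /set2P[]->; apply/card_gt0P.
    by exists y; rewrite !inE eqxx orbT.
  by exists x; rewrite !inE eqxx adj_sym.
Qed.

(** * The order of growth *)

Section Asymptotics.
Local Open Scope ring_scope.

(** Writing [L] for [ln d], the hypotheses give [256 * k <= L], so that the
    logarithm of [threshold k ^ s], which is [8 * k * s * ln (256 * k)], is at
    most [8 * k * s * ln L <= L]. *)
Lemma threshold_le (R : realType) (s k d : nat) : (0 < s)%N -> (0 < k)%N ->
  1 <= ln (ln d%:R) :> R ->
  (256 * s)%:R * k%:R <= ln d%:R / ln (ln d%:R) :> R ->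
  (threshold k ^ s <= d)%N.
Proof.
set L : R := ln d%:R; set M := ln L => s0 k0 M1 kLM.
have M0 : 0 < M by apply: lt_le_trans M1.
have L0 : 0 < L.
  by rewrite ltNge; apply/negP => /ln0 E; move: M0; rewrite /M E ltxx.
have d0 : 0 < d%:R :> R.
  by rewrite ltNge; apply/negP => /ln0 E; move: L0; rewrite /L E ltxx.
have s1 : 1 <= s%:R :> R by rewrite ler1n.
have k1 : 1 <= k%:R :> R by rewrite ler1n.
have kL : (256 * s)%:R * k%:R * M <= L by rewrite -ler_pdivlMr.
have lnk : ln (256 * k)%:R <= M.
  rewrite /M ler_ln ?posrE ?ltr0n ?muln_gt0 //.
  apply: le_trans kL; rewrite !natrM.
  have sk : k%:R <= s%:R * k%:R :> R by rewrite ler_peMl.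
  have skM : s%:R * k%:R <= s%:R * k%:R * M by rewrite ler_peMr // mulr_ge0.
  lra.
rewrite -(ler_nat R) -ler_ln ?posrE //; last first.
  by rewrite ltr0n !expn_gt0 muln_gt0 k0.
rewrite /threshold -expnM natrX lnXn ?ltr0n ?muln_gt0 // -[leLHS]mulr_natl.
set l := ln _ in lnk *; apply: le_trans kL; rewrite !natrM.
have h : 0 <= s%:R * k%:R :> R by rewrite mulr_ge0.
have h2 : s%:R * k%:R * l <= s%:R * k%:R * M :> R by rewrite ler_wpM2l.
have h3 : 0 <= s%:R * k%:R * M by rewrite mulr_ge0 // ltW.
lra.
Qed.

End Asymptotics.

Local Open Scope ring_scope.

Theorem theorem1p2 (R : realType) (H : sgraph) (H_nonempty : (0 < #|H|)%N) :
  exists2 c : R, 0 < c &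
    forall d : nat, (3 <= d)%N ->
    forall G : sgraph, (0 < #|G|)%N -> subgraph_free H G ->
      (d <= min_degree G)%N ->
    exists U : {set G},
      [/\ U != set0,
          bipartite (induced U) &
          c * (ln d%:R / ln (ln d%:R)) <= (min_degree (induced U))%:R].
Proof.
pose x (d : nat) : R := ln d%:R / ln (ln d%:R).
pose d0 := Num.bound (sequences.expR (sequences.expR 1) : R).
pose a : R := (512 * #|H|)%:R.
(* [b] bounds the ratio for the finitely many [d] with [ln (ln d) < 1]; there,
   and whenever the bound to be reached is at most 1, an edge is enough *)
pose b : R := \sum_(i < d0) `|x i|.
have b0 : 0 <= b by apply: sumr_ge0.
have a0 : 0 < a by rewrite ltr0n muln_gt0.
exists (a + b)^-1; first by rewrite invr_gt0; lra.
move=> d d3 G G0 freeG dG; rewrite -/(x d).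
suff [k [U [A core]] xk] : exists2 k, exists U A : {set G}, bipartite_core k U A &
    (a + b)^-1 * x d <= k%:R.
  have [U0 bipU kU] := bipartite_core_induced core.
  by exists U; split=> //; apply: le_trans xk _; rewrite ler_nat.
have [small|] := lerP (x d) (a + b).
  exists 1%N; last by rewrite mulrC ler_pdivrMr ?mul1r //; lra.
  by apply: edge_core => //; apply: leq_trans dG; apply: leq_trans d3.
move=> large.
have dd0 : (d0 <= d)%N.
  rewrite leqNgt; apply: contraTN large => dd0; rewrite -leNgt.
  rewrite /b (bigD1 (Ordinal dd0)) //=.
  have := ler_norm (x d).
  have : 0 <= \sum_(i < d0 | i != Ordinal dd0) `|x i| by apply: sumr_ge0.
  lra.
have de : sequences.expR (sequences.expR 1) <= d%:R :> R.
  apply: (@le_trans _ _ d0%:R); last by rewrite ler_nat.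
  by apply/ltW/archi_boundP/expR_ge0.
have M1 : 1 <= ln (ln d%:R) :> R.
  have e1 : sequences.expR 1 <= ln d%:R :> R.
    rewrite -[leLHS]expRK ler_ln ?posrE ?expR_gt0 //.
    exact: lt_le_trans (expR_gt0 _) de.
  rewrite -[leLHS]expRK ler_ln ?posrE ?expR_gt0 //.
  exact: lt_le_trans (expR_gt0 _) e1.
(* rounding [y >= 1] down to [k] loses a factor at most 2, whence the 512 in [a] *)
pose y := x d / (256 * #|H|)%:R; pose k := Num.trunc y.
have h0 : 0 < (256 * #|H|)%:R :> R by rewrite ltr0n muln_gt0.
have ah : a = 2 * (256 * #|H|)%:R by rewrite /a -natrM mulnA.
have y1 : 1 <= y by rewrite ler_pdivlMr //; lra.
have /andP[ky yk] : k%:R <= y < k.+1%:R by apply: truncn_itv; lra.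
have k0 : (0 < k)%N.
  by rewrite -(ltr_nat R); move: yk; rewrite -natr1; lra.
exists k; last first.
  rewrite mulrC ler_pdivrMr; last lra.
  have -> : x d = y * (256 * #|H|)%:R by rewrite /y mulfVK // gt_eqF.
  have k1 : 1 <= k%:R :> R by rewrite ler1n.
  have : y * (256 * #|H|)%:R <= 2 * k%:R * (256 * #|H|)%:R.
    by rewrite ler_pM2r //; move: yk; rewrite -natr1; lra.
  have : 0 <= k%:R * b by rewrite mulr_ge0.
  rewrite ah; lra.
apply: (@clique_free_bipartite_core #|H| k G setT) => //.
- by rewrite -card_gt0 cardsT.
- by move=> C _ CH; apply: subgraph_free_clique freeG CH.
move=> v _; rewrite /degin setTI.
apply: leq_trans (leq_trans dG (min_degree_le v)).
apply: (@threshold_le R) => //.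
by rewrite mulrC -ler_pdivlMr.
Qed.
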